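(* Let $p>0$, $q\ge 0$ be integers and let $\mathcal{S}=\{1,\dots,p+q+1\}$. The map $m\mapsto c_{\mathbb{R}}(m)$ defines a bijection from the set of isometry classes of marked simplices in $\mathbb{H}^{p,q}$ to the set of cohomology classes $c\in\mathrm{H}^1(\mathcal{S},\mathbb{R})$ of signature $\mathrm{sgn}(c)=(p,q+1)$.
   Context: Geometry. Let $\mathbb{R}^{p,q+1}$ be $\mathbb{R}^{p+q+1}$ with a non-degenerate symmetric bilinear form $\mathbf{b}$ of signature $(p,q+1)$ ($p$ positive, $q+1$ negative), $\mathrm{PO}(p,q+1)=\mathrm{O}(p,q+1)/\{\pm\mathrm{id}\}$, and $\mathbb{H}^{p,q}=\{[x]\in\mathbb{P}(\mathbb{R}^{p,q+1})\mid\mathbf{b}(x,x)<0\}$. A lift of $\Lambda\subset\mathbb{P}(\mathbb{R}^{p,q+1})$ is a map $s$ choosing for each line $\xi\in\Lambda$ a non-zero vector $s(\xi)\in\xi$; it is positive if $0\notin\mathrm{Conv}(s(\Lambda))$ and $\mathbf{b}(s(\xi),s(\eta))\le0$ for all $\xi,\eta\in\Lambda$ (including $\xi=\eta$). If $s$ is positive, $\mathrm{Conv}(s)$ is the interior of the projectivisation of $\mathrm{Conv}(s(\Lambda))$; such a set is called a convex hull of $\Lambda$. A simplex of $\mathbb{H}^{p,q}$ is a set $\Lambda\subset\mathbb{P}(\mathbb{R}^{p,q+1})$ of $p+q+1$ points spanning $\mathbb{R}^{p,q+1}$, admitting a positive lift, and each point of which is extremal in a convex hull of $\Lambda$ (not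 a non-trivial convex combination of points of $\Lambda$). A marked simplex is a bijection $m$ from $\mathcal{S}=\{1,\dots,p+q+1\}$ onto a simplex. Two marked simplices $m,m'$ are isometric if $m'=\phi\circ m$ for some $\phi\in\mathrm{PO}(p,q+1)$. Graphs and cohomology. A graph $\mathcal{G}=(\mathcal{S},\mathcal{A})$ has vertex set $\mathcal{S}$ and edges $\{i,j\}\subset\mathcal{S}$, loops ($i=j$) being allowed. For an abelian group $(G,\star)$, $\mathrm{C}^0(\mathcal{G},G)=G^{\mathcal{S}}$, $\mathrm{C}^1(\mathcal{G},G)=G^{\mathcal{A}}$, $\mathrm{d}f(\{i,j\})=f(i)\star f(j)$ (also for $i=j$), and $\mathrm{H}^1(\mathcal{G},G)=\mathrm{C}^1(\mathcal{G},G)/\mathrm{d}\,\mathrm{C}^0(\mathcal{G},G)$. Here $G=(\mathbb{R},+)$. The set $\mathrm{H}^1(\mathcal{S},\mathbb{R})$ is the disjoint union of the $\mathrm{H}^1(\mathcal{G},\mathbb{R})$ over all graphs $\mathcal{G}$ with vertex set $\mathcal{S}$. Signature. For $f\in\mathrm{C}^1(\mathcal{G},\mathbb{R})$, let $M$ be the real symmetric matrix with entries $M_{ij}=-\exp(f(\{i,j\}))$ if $\{i,j\}$ is an edge of $\mathcal{G}$ and $M_{ij}=0$ otherwise. The signature of the class of $f$ in $\mathrm{H}^1(\mathcal{G},\mathbb{R})$ is the signature (number of positive, number of negative eigenvalues) of $M$; it depends only on the class. The class of a marked simplex. Let $m:\mathcal{S}\to\Lambda$ be a marked simplex. Let $\mathcal{G}(m)$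 be the graph with vertex set $\mathcal{S}$ whose edges are the $\{i,j\}$ (possibly $i=j$) such that the lines $m(i)$ and $m(j)$ are not $\mathbf{b}$-orthogonal. Then $c_{\mathbb{R}}(m)\in\mathrm{H}^1(\mathcal{G}(m),\mathbb{R})\subset\mathrm{H}^1(\mathcal{S},\mathbb{R})$ is the class of the cochain $\{i,j\}\mapsto\log|\mathbf{b}(s(m(i)),s(m(j)))|$, where $s$ is any lift of $\Lambda$; it does not depend on $s$. *)

(* Defs.v *)
From HB Require Import structures.
From mathcomp Require Import all_boot all_order all_algebra.
From mathcomp Require Import sesquilinear generic_quotient ring_quotient.
From mathcomp Require Import polyrcf.
From mathcomp Require Import boolp classical_sets functions cardinality.
From mathcomp Require Import reals sequences convex exp.

Set Implicit Arguments.
Unset Strict Implicit.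
Unset Printing Implicit Defensive.

Import Order.TTheory GRing.Theory Num.Theory.
Local Open Scope classical_set_scope.
Local Open Scope ring_scope.
Local Open Scope quotient_scope.

Section Signature.
Variables (R : rcfType) (n : nat).

(* Numbers of positive and of negative eigenvalues, with multiplicity. *)
Definition signature (M : 'M[R]_n) : nat * nat :=
  let chi := char_poly M in
  ((\sum_(x <- rootsR chi | (0 < x)%R) mup x chi)%N,
   (\sum_(x <- rootsR chi | (x < 0)%R) mup x chi)%N).

End Signature.

Section Edges.
Variable n : nat.

(* Unordered pairs {i, j}; the singletons are the loops i = j. *)
Definition is_edge : pred {set 'I_n} :=
  fun e => [exists ij : 'I_n * 'I_n, e == [set ij.1; ij.2]%SET].

Definition edge := {e : {set 'I_n} | is_edge e}.

Definition graph := {set edge}.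

Fact mkedge_proof (i j : 'I_n) : is_edge [set i; j]%SET.
Proof. by apply/existsP; exists (i, j). Qed.

Definition mkedge (i j : 'I_n) : edge :=
  exist (fun e => is_true (is_edge e)) _ (mkedge_proof i j).

Definition ends (e : edge) : 'I_n * 'I_n := xchoose (existsP (valP e)).

Lemma mkedge_ends (e : edge) : mkedge (ends e).1 (ends e).2 = e.
Proof. by apply/val_inj/esym/eqP; exact: (xchooseP (existsP (valP e))). Qed.

(* The value of h on an edge; the choice of the order of the two ends is
   irrelevant when h is symmetric, see edge_funE. *)
Definition edge_fun (T : Type) (h : 'I_n -> 'I_n -> T) (e : edge) : T :=
  h (ends e).1 (ends e).2.

Lemma mkedge_inj (i j k l : 'I_n) :
  mkedge i j = mkedge k l -> (i, j) = (k, l) \/ (i, j) = (l, k).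
Proof.
move=> /(congr1 val) /= /setP E.
move: (E i) (E j) (E k) (E l); rewrite !inE !eqxx ?orbT /=.
move=> /esym/orP ik /esym/orP jk /orP ki /orP li.
case: ik => /eqP ik; case: jk => /eqP jk; subst; auto.
- by case: li => /eqP ->; auto.
- by case: ki => /eqP ->; auto.
Qed.

Lemma edge_funE (T : Type) (h : 'I_n -> 'I_n -> T) (i j : 'I_n) :
  (forall k l, h k l = h l k) -> edge_fun h (mkedge i j) = h i j.
Proof.
move=> hC; rewrite /edge_fun.
by case: (mkedge_inj (mkedge_ends (mkedge i j))) => -[-> ->].
Qed.

End Edges.

Section Cohomology.
Variables (n : nat) (A : zmodType).

Definition C0 := {ffun 'I_n -> A}.
Definition C1 (G : graph n) := {ffun {e : edge n | e \in G} -> A}.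

Definition cobound (G : graph n) (f : C0) : C1 G :=
  [ffun e => edge_fun (fun i j => f i + f j) (val e)].

Arguments cobound G : clear implicits.

Definition B1 (G : graph n) : {pred C1 G} :=
  fun c => `[< exists f : C0, c = cobound G f >].

Arguments B1 G : clear implicits.

Fact B1_closed (G : graph n) : zmod_closed (B1 G).
Proof.
split.
  apply/asboolP; exists 0; apply/ffunP => e.
  by rewrite !ffunE /edge_fun !ffunE addr0.
move=> _ _ /asboolP[f ->] /asboolP[g ->]; apply/asboolP; exists (f - g).
by apply/ffunP => e; rewrite !ffunE /edge_fun !ffunE opprD addrACA.
Qed.

HB.instance Definition _ (G : graph n) :=
  GRing.isZmodClosed.Build (C1 G) (B1 G) (B1_closed G).

Definition H1 (G : graph n) := Quotient.quot (B1 G).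

(* Disjoint union of the H1 G over all graphs G with vertex set 'I_n. *)
Definition H1S := {G : graph n & H1 G}.

End Cohomology.

Section ClassSignature.
Variables (R : realType) (n : nat).

Definition cochain_mx (G : graph n) (f : C1 R G) : 'M[R]_n :=
  \matrix_(i, j) if insub (mkedge i j) is Some e then - expR (f e) else 0.

(* By Sylvester's law of inertia the signature does not depend on the
   representative of the class. *)
Definition sgn (c : H1S n R) : nat * nat :=
  signature (cochain_mx (repr (tagged c))).

End ClassSignature.

Section Simplices.
Variables (R : realType) (n : nat).
Local Notation V := 'rV[R]_n.
Variable b : {symmetric V}.

Definition proj := {l : {vspace V} | \dim l == 1%N}.

Implicit Types (L : set proj) (s : proj -> V) (x y : proj).

(* Only the values of s on L are meaningful. *)
Definition is_lift L s := forall x, L x -> s x \in val x /\ s x != 0.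

Definition Conv (X : set V) : set V := smallest (@convex_set R V) X.

Definition positive_lift L s :=
  [/\ is_lift L s, ~ Conv (s @` L) 0 & forall x y, L x -> L y -> b (s x) (s y) <= 0].

(* The point x of L is extremal in the convex hull of L given by s: in the
   affine chart defined by s, only trivial convex combinations of points of L
   represent x. *)
Definition extremal L s x :=
  forall (k : nat) (y : 'I_k -> proj) (t : 'I_k -> R),
    (forall i, L (y i)) -> (forall i, 0 < t i) -> \sum_i t i = 1 ->
    \sum_i t i *: s (y i) \in val x -> forall i, y i = x.

Definition spanning L :=
  forall U : {vspace V}, (forall x, L x -> (val x <= U)%VS) -> U = fullv.

Definition simplex L :=
  [/\ (L #= `I_n)%card, spanning L &
      exists2 s, positive_lift L s & forall x, L x -> extremal L s x].

Definition marked_simplex :=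
  {m : {ffun 'I_n -> proj} |
    `[< exists2 L, simplex L & set_bij [set: 'I_n] L m >]}.

Definition orthogonal_group : set 'End(V) :=
  [set g | lker g = 0%VS /\ forall u v, b (g u) (g v) = b u v].

(* O(p, q+1)/{+-id} as a group of transformations of the projective space. *)
Definition PO : set (proj -> proj) :=
  [set phi | exists2 g, orthogonal_group g &
                        forall x, val (phi x) = (g @: val x)%VS].

Definition isometric (m m' : marked_simplex) : bool :=
  `[< exists2 phi, PO phi & forall i, val m' i = phi (val m i) >].

Fact proj_map_proof (g : 'End(V)) x : lker g = 0%VS -> \dim (g @: val x) == 1%N.
Proof. by move=> g0; rewrite limg_dim_eq ?(valP x)// g0 capv0. Qed.

Fact isometric_refl : reflexive isometric.
Proof.
move=> m; apply/asboolP; exists id => //; exists \1%VF.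
  split=> [|u v]; last by rewrite !id_lfunE.
  by apply/eqP; rewrite -subv0; apply/subvP => v; rewrite memv_ker id_lfunE memv0.
by move=> x; rewrite lim1g.
Qed.

Fact isometric_sym : symmetric isometric.
Proof.
suff H m m' : isometric m m' -> isometric m' m.
  by move=> m m'; apply/idP/idP; exact: H.
move=> /asboolP[phi [g [/eqP g0 gb] Hphi] Hm]; apply/asboolP.
have gK := lker0_lfunVK g0.
have h0 : lker (g^-1)%VF = 0%VS.
  by apply/eqP/lker0P => u v E; rewrite -[u]gK E gK.
exists (fun x => exist (fun l => is_true (\dim l == 1%N)) _ (proj_map_proof x h0)).
  exists (g^-1)%VF => //; split=> // u v.
  by rewrite -[RHS](congr2 b (gK u) (gK v)) gb.
move=> i; apply/val_inj => /=.
by rewrite Hm Hphi -limg_comp lker0_compVf// lim1g.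
Qed.

Fact isometric_trans : transitive isometric.
Proof.
move=> m2 m1 m3 /asboolP[phi [g [/eqP g0 gb] Hphi] Hm].
move=> /asboolP[psi [h [/eqP h0 hb] Hpsi] Hm']; apply/asboolP.
exists (psi \o phi); last by move=> i; rewrite Hm' Hm.
exists (h \o g)%VF; last by move=> x; rewrite /= Hpsi Hphi limg_comp.
split=> [|u v]; last by rewrite !lfunE /= hb gb.
apply/eqP/lker0P => u v; rewrite !lfunE /=.
by move=> /(lker0P h0)/(lker0P g0).
Qed.

Canonical isometric_equiv :=
  EquivRel isometric isometric_refl isometric_sym isometric_trans.

Definition isometry_class := {eq_quot isometric}.

Definition simplex_graph (m : marked_simplex) : graph n :=
  [set e | edge_fun
     (fun i j => ~~ (val (val m i) <= orthov b (val (val m j)))%VS) e]%SET.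

Definition lift_cochain (s : proj -> V) (m : marked_simplex) :
    C1 R (simplex_graph m) :=
  [ffun e => edge_fun (fun i j => ln `|b (s (val m i)) (s (val m j))|) (val e)].

(* The class c_R(m), computed with one particular lift; by cRE below any lift
   can be used. *)
Definition cR (m : marked_simplex) : H1S n R :=
  Tagged (fun G => H1 R G)
    (\pi_(H1 R (simplex_graph m)) (lift_cochain (fun x => vpick (val x)) m)).

Lemma cRE (m : marked_simplex) (s : proj -> V) :
  is_lift (range (val m)) s ->
  cR m = Tagged (fun G => H1 R G) (\pi_(H1 R (simplex_graph m)) (lift_cochain s m)).
Proof.
move=> sP; rewrite /cR; congr Tagged.
apply/eqP; rewrite -Quotient.idealrBE; apply/asboolP.
pose x i : proj := val m i.
have sl i : val (x i) = <[s (x i)]>%VS.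
  have [sx s0] := sP (x i) (ex_intro2 _ _ i I erefl).
  apply/esym/eqP; rewrite eqEdim; apply/andP; split; first by rewrite -memvE.
  by rewrite dim_vline s0 (eqP (valP (x i))).
have kP i : exists k, vpick (val (x i)) = k *: s (x i).
  by apply/vlineP; rewrite -sl memv_pick.
have [k kE] := choice kP.
have k0 i : k i != 0.
  apply/eqP => ki0; have /eqP := kE i; rewrite ki0 scale0r vpick0 => /eqP xi0.
  by have := valP (x i); rewrite xi0 dimv0.
exists [ffun i => ln `|k i|]; apply/ffunP => -[e eG].
rewrite !ffunE /edge_fun /= !ffunE; move: eG; rewrite inE /edge_fun.
set i := (ends e).1; set j := (ends e).2 => ij.
rewrite -/(x i) -/(x j) in ij *.
have bij : b (s (x i)) (s (x j)) != 0.
  apply: contraNneq ij => bij; rewrite [X in (X <= _)%VS]sl -memvE.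
  apply/mem_orthovP => v vj.
  have /vlineP[a ->] : v \in <[s (x j)]>%VS by rewrite -sl.
  by rewrite linearZ /= bij mulr0.
rewrite !kE linearZlr/= !normrM.
rewrite !lnM ?posrE ?mulr_gt0 ?normr_gt0//.
by rewrite addrA addrK.
Qed.

End Simplices.

(* Main.v *)
Require Import Defs.
From mathcomp Require Import all_boot all_order all_algebra.
From mathcomp Require Import sesquilinear generic_quotient ring_quotient.
From mathcomp Require Import perm polyrcf complex ring.
From mathcomp Require Import unstable boolp classical_sets functions cardinality.
From mathcomp Require Import reals sequences convex exp.

Set Implicit Arguments.
Unset Strict Implicit.
Unset Printing Implicit Defensive.

Import Order.TTheory GRing.Theory Num.Theory.
Local Open Scope classical_set_scope.
Local Open Scope ring_scope.
Local Open Scope quotient_scope.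

(* A positive lift of a marked simplex is a basis v_i with b(v_i, v_j) <= 0, and
   its Gram matrix is exactly the matrix M attached to the cochain
   log |b(v_i, v_j)|. Rescaling the v_i by positive factors c_i changes M_ij into
   c_i c_j M_ij, which is adding the coboundary of log c. So a cohomology class is
   a nonpositive symmetric matrix up to positive diagonal congruence, and the
   signature of c_R(m) is that of b by Sylvester's law of inertia. Two bases
   with the same Gram matrix differ by an isometry, which gives injectivity.
   Conversely a symmetric matrix with the signature of b is the Gram matrix of
   some basis, and a basis with nonpositive Gram matrix always spans a simplex:
   linear independence gives both extremality and 0 outside the convex hull. *)

(** * Spectral theorem and Sylvester's law of inertia *)

Definition posdef (R : numDomainType) n (A : 'M[R]_n) :=
  forall u : 'rV_n, u != 0 -> 0 < (u *m A *m u^T) 0 0.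

Lemma posdef_unitmx (R : numFieldType) n (A : 'M[R]_n) : posdef A -> A \in unitmx.
Proof.
move=> Apos; rewrite -row_free_unit; apply/inj_row_free => u uA0.
by apply: contraTeq (erefl true) => /Apos; rewrite uA0 mul0mx mxE ltxx.
Qed.

Lemma posdef1 (R : realDomainType) n : posdef (1%:M : 'M[R]_n).
Proof.
move=> u u0; rewrite mulmx1 mxE.
under eq_bigr do rewrite mxE -expr2.
rewrite lt0r sumr_ge0 ?andbT => [|i _]; last exact: sqr_ge0.
apply: contraNneq u0 => /eqP; rewrite psumr_eq0 => [/allP u0|i _]; last exact: sqr_ge0.
apply/eqP/rowP => i; rewrite mxE; apply/eqP.
by have := u0 i (mem_index_enum i); rewrite sqrf_eq0.
Qed.

Lemma symmx_form (R : comPzRingType) n (M : 'M[R]_n) (x y : 'rV_n) :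
  M^T = M -> (x *m M *m y^T) 0 0 = (y *m M *m x^T) 0 0.
Proof.
move=> Msym; rewrite -[LHS](mxE trmx_key (fun i j => (x *m M *m y^T) j i)).
by rewrite -/(trmx _) !trmx_mul trmxK Msym mulmxA.
Qed.

(* Split a complex eigenvector as x + iy and the eigenvalue as a + ib: the
   symmetry of M forces b (xAx^T + yAy^T) = 0, hence b = 0. *)
Lemma symmx_eigenpair (R : rcfType) n (A M : 'M[R]_n.+1) :
  posdef A -> A^T = A -> M^T = M ->
  exists l (u : 'rV_n.+1), u != 0 /\ u *m M = l *: (u *m A).
Proof.
move=> Apos Asym Msym.
(* With [N = M A^-1], the relation [u *m M = l *: (u *m A)] becomes the ordinary eigenvector
   equation [u *m N = l *: u]. *)
have [N NA] : exists N, N *m A = M.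
  by exists (M *m invmx A); rewrite mulmxKV ?posdef_unitmx.
have [rc rcE] : exists rc : {rmorphism R -> R[i]}, forall x, rc x = x%:C%C.
  by exists (real_complex R).
(* The size [n.+1] makes the characteristic polynomial nonconstant, so it has a root in the
   algebraically closed [R[i]]. *)
have [l] : exists l, root (char_poly (map_mx rc N)) l.
  by apply: closed_rootP; rewrite size_char_poly.
rewrite -eigenvalue_root_char => /eigenvalueP[v vN v0].
pose x := map_mx (@complex.Re R) v; pose y := map_mx (@complex.Im R) v.
have vE : v = map_mx rc x + 'i%C *: map_mx rc y.
  by apply/rowP => i; rewrite !mxE !rcE -complexE.
have xy_eq0 (x' y' : 'rV[R]_n.+1) :
    map_mx rc x' + 'i%C *: map_mx rc y' = 0 -> x' = 0 /\ y' = 0.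
  move=> /rowP E; split; apply/rowP => i; have := E i; rewrite !mxE !rcE;
  by simpc => -[].
case: l vN => a b vN.
have [xN yN] : x *m N - (a *: x - b *: y) = 0 /\ y *m N - (a *: y + b *: x) = 0.
  apply: xy_eq0; rewrite -[RHS](subrr (Complex a b *: v)) -{1}vN vE mulmxDl.
  rewrite -scalemxAl !(map_mxB, map_mxD, map_mxZ, map_mxM).
  have -> : Complex a b = rc a + 'i%C * rc b by rewrite !rcE; simpc.
  move: (map_mx _ x) (map_mx _ y) (map_mx _ N) => X Y Z.
  move: (X *m Z) (Y *m Z) => P Q; apply/rowP => i; rewrite !mxE.
  have ii : 'i%C * 'i%C = -1 :> R[i] by simpc.
  ring: ii.
have {xN}xM : x *m M = a *: (x *m A) - b *: (y *m A).
  by rewrite -NA mulmxA (subr0_eq xN) mulmxBl -!scalemxAl.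
have {yN}yM : y *m M = a *: (y *m A) + b *: (x *m A).
  by rewrite -NA mulmxA (subr0_eq yN) mulmxDl -!scalemxAl.
have b0 : b = 0.
  have qge0 (u : 'rV_n.+1) : 0 <= (u *m A *m u^T) 0 0.
    have [->|u0] := eqVneq u 0; last by apply: ltW; exact: Apos.
    by rewrite !mul0mx mxE.
  have : 0 < (x *m A *m x^T) 0 0 + (y *m A *m y^T) 0 0.
    have [x0|x0] := eqVneq x 0; last by rewrite ltr_wpDr ?Apos.
    rewrite ltr_wpDl// Apos//; apply: contraNneq v0 => y0.
    by apply/eqP/rowP => i; rewrite vE x0 y0 !mxE !rmorph0 mulr0 addr0.
  have := symmx_form x y Msym; have := symmx_form x y Asym.
  rewrite xM yM !(mulmxBl, mulmxDl) -!scalemxAl !mxE => -> E /lt0r_neq0 xy0.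
  apply: (mulIf xy0); rewrite mul0r mulrDr.
  by move/eqP: E; rewrite -subr_eq0 => /eqP E; apply: oppr_inj;
     rewrite oppr0 -[RHS]E; ring.
(* With a real eigenvalue, [x] and [y] satisfy the equation separately, and one of them is
   nonzero. *)
have [x0|x0] := eqVneq x 0; last first.
  by exists a, x; split=> //; rewrite xM b0 scale0r subr0.
exists a, y; split; last by rewrite yM b0 scale0r addr0.
apply: contraNneq v0 => y0.
by apply/eqP/rowP => i; rewrite vE x0 y0 !mxE !rmorph0 mulr0 addr0.
Qed.

(** In the rank normal form of [u], the first row of [row_ebase u] is proportional to [u], so the
    remaining [n] rows complete [u] to a basis. *)
Lemma complete_unitmx (F : fieldType) n (u : 'rV[F]_(1 + n)) :
  u != 0 -> exists V : 'M_(n, 1 + n), col_mx u V \in unitmx.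
Proof.
move=> u0; have ru : \rank u = 1%N by apply/eqP; rewrite rank_rV u0.
have := mulmx_ebase u; rewrite ru.
have -> : pid_mx 1 = row_mx 1%:M 0 :> 'M[F]_(1, 1 + n).
  by rewrite pid_mx_row.
move=> uE; exists (row_mx 0 1%:M *m row_ebase u).
rewrite -{1}uE mul_mx_row mulmx1 mulmx0 -mul_col_mx unitmx_mul row_ebase_unit andbT.
by rewrite unitmxE det_ublock det1 mulr1 -unitmxE col_ebase_unit.
Qed.

(* Diagonalising a pair (A, M) rather than M alone keeps the statement stable
   under passing to the A-orthogonal of an eigenvector, so that no
   orthonormalisation is needed. *)
Lemma symmx_codiag (R : rcfType) n (A M : 'M[R]_n) :
  posdef A -> A^T = A -> M^T = M ->
  exists P (d : 'rV_n), [/\ P \in unitmx, P *m A *m P^T = 1%:M &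
                            P *m M *m P^T = diag_mx d].
Proof.
elim: n A M => [|n IHn] A M Apos Asym Msym.
  exists 1%:M, 0; split; rewrite ?unitmx1// [LHS]flatmx0 [RHS]flatmx0//.
have [l [u [u0 uM]]] := symmx_eigenpair Apos Asym Msym.
wlog u1 : u u0 uM / (u *m A *m u^T) = 1%:M.
  move=> /(_ ((Num.sqrt ((u *m A *m u^T) 0 0))^-1 *: u)); apply.
  - by rewrite scaler_eq0 invr_eq0 negb_or u0 sqrtr_eq0 -ltNge Apos.
  - by rewrite -!scalemxAl uM scalerA mulrC -scalerA.
  rewrite -!scalemxAl linearZ/= -scalemxAr scalerA -invfM -expr2.
  rewrite sqr_sqrtr ?ltW ?Apos//; apply/matrixP => i j.
  by rewrite !ord1 mxE mulVf ?lt0r_neq0 ?Apos// mxE.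
have [V Vu] := complete_unitmx (u0 : (u : 'rV_(1 + n)) != 0).
(* Gram-Schmidt for [A]: the component along the unit vector [u] is removed from every row of
   [V]. *)
pose W := V - V *m A *m u^T *m u.
have WAu : W *m A *m u^T = 0.
  rewrite /W !mulmxBl -[_ *m u *m A *m _]mulmxA -[_ *m u *m _]mulmxA.
  by rewrite [u *m (A *m _)]mulmxA u1 mulmx1 subrr.
have uAW : u *m A *m W^T = 0.
  by apply: trmx_inj; rewrite !trmx_mul trmxK Asym trmx0 mulmxA WAu.
(* As [u *m M] is a multiple of [u *m A], being [A]-orthogonal to [u] implies being [M]-orthogonal
   to it; both forms become block diagonal. *)
have uMW : u *m M *m W^T = 0 by rewrite uM -scalemxAl uAW scaler0.
have WMu : W *m M *m u^T = 0.
  by apply: trmx_inj; rewrite !trmx_mul trmxK Msym trmx0 mulmxA uMW.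
have uMu : u *m M *m u^T = l%:M by rewrite uM -scalemxAl u1 scalemx1.
have Qu : col_mx u W \in unitmx.
  have -> : col_mx u W =
      block_mx 1%:M 0 (- (V *m A *m u^T)) 1%:M *m (col_mx u V : 'M_(1 + n)).
    by rewrite mul_block_col !mul1mx mul0mx addr0 mulNmx addrC.
  by rewrite unitmx_mul Vu andbT unitmxE det_lblock !det1 mulr1 unitr1.
have [||| P [d [Pu PA PM]]] := IHn (W *m A *m W^T) (W *m M *m W^T).
- move=> v v0; rewrite !mulmxA -[_ *m W^T *m v^T]mulmxA -trmx_mul.
  apply: Apos; apply: contra_neq v0 => vW0.
  have : row_mx 0 v *m (col_mx u W : 'M_(1 + n)) = 0.
    by rewrite mul_row_col mul0mx add0r.
  move/(congr1 (mulmx^~ (invmx (col_mx u W)))); rewrite mulmxK// mul0mx.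
  by rewrite -row_mx0 => /eq_row_mx[].
- by rewrite !trmx_mul trmxK Asym mulmxA.
- by rewrite !trmx_mul trmxK Msym mulmxA.
pose B : 'M_(1 + n) := block_mx 1%:M 0 0 P.
have Bu : B \in unitmx by rewrite unitmxE det_ublock det1 mul1r -unitmxE.
have BQ N : B *m col_mx u W *m N *m (B *m col_mx u W)^T =
    block_mx (u *m N *m u^T) (u *m N *m W^T *m P^T)
             (P *m (W *m N *m u^T)) (P *m (W *m N *m W^T) *m P^T).
  rewrite mul_block_col !mul0mx mul1mx addr0 add0r tr_col_mx mul_col_mx.
  by rewrite mul_col_row !trmx_mul !mulmxA.
exists (B *m col_mx u W), (row_mx (const_mx l) d : 'rV_(1 + n)); split.
- by rewrite unitmx_mul Bu.
- by rewrite BQ u1 uAW WAu PA mul0mx mulmx0 -scalar_mx_block.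
- by rewrite BQ uMu uMW WMu PM mul0mx mulmx0 (@diag_mx_row _ n 1) diag_const_mx.
Qed.

(** * Signatures read off diagonal forms *)

Lemma char_poly_conjmx (R : comNzRingType) n (P Q M : 'M[R]_n) :
  P *m Q = 1%:M -> char_poly (P *m M *m Q) = char_poly M.
Proof.
move=> PQ; rewrite /char_poly.
have PQX : map_mx polyC P *m map_mx polyC Q = 1%:M by rewrite -map_mxM PQ map_mx1.
have -> : char_poly_mx (P *m M *m Q) =
    map_mx polyC P *m char_poly_mx M *m map_mx polyC Q.
  by rewrite /char_poly_mx mulmxBr mulmxBl scalar_mxC -[_%:M *m _ *m _]mulmxA
     PQX mulmx1 !map_mxM.
by rewrite !det_mulmx mulrAC -det_mulmx PQX det1 mul1r.
Qed.

(** Negative entries are counted by [pos_index (- d)], so one inequality on positive entries serves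
    for both signs. *)
Definition pos_index (R : numDomainType) n (d : 'rV[R]_n) := #|[pred i | 0 < d 0 i]|.

(** The characteristic polynomial splits into the factors ['X - (d 0 i)%:P], so the multiplicity of
    a root is its number of occurrences in [d]. *)
Lemma signature_diag (R : rcfType) n (M : 'M[R]_n) (d : 'rV_n) :
  char_poly M = char_poly (diag_mx d) ->
  signature M = (pos_index d, pos_index (- d)).
Proof.
move=> Md; pose s := [seq d 0 i | i : 'I_n].
have ME : char_poly M = \prod_(x <- s) ('X - x%:P).
  rewrite Md char_poly_trig ?diag_mx_is_trig// big_image/=.
  by apply: eq_bigr => i _; rewrite mxE eqxx.
have M0 : char_poly M != 0 by rewrite monic_neq0 ?char_poly_monic.
have mem_roots x : (x \in rootsR (char_poly M)) = (x \in s).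
  have := roots_on_rootsR M0 x; rewrite inE /= => <-.
  by rewrite ME root_prod_XsubC.
have sumE (Q : pred R) : (\sum_(x <- rootsR (char_poly M) | Q x) mup x (char_poly M))%N
    = #|[pred i | Q (d 0 i)]|.
  transitivity (\sum_(x <- undup s | Q x) count_mem x s)%N.
    rewrite (perm_big (undup s)) /=.
      by apply: eq_bigr => x _; rewrite ME mu_prod_XsubC.
    apply: uniq_perm; rewrite ?undup_uniq ?uniq_roots// => x.
    by rewrite mem_undup mem_roots.
  transitivity (\sum_(x <- s | Q x) 1)%N; last first.
    by rewrite big_image_cond/= sum1_card; apply: eq_card => i; rewrite !inE.
  rewrite -[RHS]big_undup_iterop_count; apply: eq_bigr => x _.
  by elim: (count_mem x s) => // -[|k]//= <-.
rewrite /signature !sumE; congr (_, _); apply: eq_card => i.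
by rewrite !inE mxE oppr_gt0.
Qed.

(** Taking [A = 1] in [symmx_codiag] makes [P] orthogonal: the congruence is then also a conjugation
    and preserves the eigenvalues. *)
Lemma symmx_spectral (R : rcfType) n (M : 'M[R]_n) :
  M^T = M ->
  exists P (d : 'rV_n), [/\ P \in unitmx, P *m M *m P^T = diag_mx d &
                            signature M = (pos_index d, pos_index (- d))].
Proof.
move=> Msym; have [P [d [Pu PP PM]]] := symmx_codiag (@posdef1 R n) (trmx1 _ _) Msym.
rewrite mulmx1 in PP; exists P, d; split=> //; apply: signature_diag.
by rewrite -PM char_poly_conjmx.
Qed.

Lemma diag_form (R : comPzRingType) n (d u : 'rV[R]_n) :
  (u *m diag_mx d *m u^T) 0 0 = \sum_i d 0 i * u 0 i ^+ 2.
Proof.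
rewrite mxE; apply: eq_bigr => i _.
by rewrite mul_mx_diag !mxE mulrAC mulrC.
Qed.

(** * Sylvester's law of inertia and its converse *)

Lemma rank_diag_indicator (F : fieldType) n (Q : pred 'I_n) :
  (\rank (diag_mx (\row_i (Q i)%:R) : 'M[F]_n) <= #|Q|)%N.
Proof.
have -> : diag_mx (\row_i (Q i)%:R) = \sum_(i | Q i) delta_mx i i :> 'M[F]_n.
  apply/matrixP => i j; rewrite summxE !mxE.
  rewrite big_mkcond (bigD1 i)//= big1 ?addr0 => [|k ki].
    by rewrite mxE eqxx/= eq_sym; case: (Q i); case: eqP.
  by rewrite mxE eq_sym (negPf ki); case: ifP.
rewrite -sum1_card; elim/big_rec2: _ => [|i k A _ IH]; first by rewrite mxrank0.
by rewrite (leq_trans (mxrank_add _ _))// leq_add// mxrank_delta.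
Qed.

(* Otherwise some nonzero u is supported where d > 0 while uQ is supported
   where d' <= 0, and u evaluates the form both positively and nonpositively. *)
Lemma inertia_leq (R : realFieldType) n (d d' : 'rV[R]_n) (Q : 'M_n) :
  Q *m diag_mx d' *m Q^T = diag_mx d -> (pos_index d <= pos_index d')%N.
Proof.
move=> QE; rewrite leqNgt; apply/negP => lt_d'd.
(* Coordinate projections encoding the two support conditions as [u *m I = 0] and
   [u *m (Q *m J) = 0]. *)
pose I : 'M[R]_n := diag_mx (\row_i (d 0 i <= 0)%R%:R).
pose J : 'M[R]_n := diag_mx (\row_i (0 < d' 0 i)%R%:R).
have [u u0 [uI uJ]] : exists2 u : 'rV_n, u != 0 & u *m I = 0 /\ u *m (Q *m J) = 0.
  (* The two conditions have total rank at most [(n - pos_index d) + pos_index d'], which is less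
     than [n]. *)
  have K0 : kermx (row_mx I (Q *m J)) != 0.
    rewrite -mxrank_eq0 mxrank_ker -lt0n subn_gt0.
    have -> : row_mx I (Q *m J) = I *m row_mx 1%:M 0 + Q *m J *m row_mx 0 1%:M.
      by rewrite !mul_mx_row !mulmx1 !mulmx0 add_row_mx addr0 add0r.
    rewrite (leq_ltn_trans (mxrank_add _ _))//.
    rewrite (@leq_ltn_trans (#|[predC [pred i | (0 < d 0 i)%R]]| + pos_index d')%N)//.
      apply: leq_add; apply: leq_trans (mxrankM_maxl _ _) _.
        rewrite (leq_trans (rank_diag_indicator _ _))// subset_leq_card//.
        by apply/fintype.subsetP => i; rewrite !inE -leNgt.
      exact: leq_trans (mxrankM_maxr _ _) (rank_diag_indicator _ _).
    have nE := cardC [pred i | 0 < d 0 i]; rewrite card_ord in nE.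
    by apply: leq_trans (eq_leq nE); rewrite addnC ltn_add2r.
  have /rowV0Pn[u /sub_kermxP uK u0] := K0; exists u => //.
  by apply: eq_row_mx; rewrite -mul_mx_row uK row_mx0.
have uI0 i : d 0 i <= 0 -> u 0 i = 0.
  by move/rowP/(_ i): uI; rewrite mul_mx_diag !mxE => + d0; rewrite d0 mulr1.
have uJ0 i : 0 < d' 0 i -> (u *m Q) 0 i = 0.
  by move/rowP/(_ i): uJ; rewrite mulmxA mul_mx_diag !mxE => + d0; rewrite d0 mulr1.
have := diag_form d u; rewrite -QE !mulmxA -[_ *m Q^T *m _]mulmxA -trmx_mul diag_form.
move=> E; suff : \sum_i d' 0 i * (u *m Q) 0 i ^+ 2 < \sum_i d 0 i * u 0 i ^+ 2.
  by rewrite E ltxx.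
rewrite (@le_lt_trans _ _ 0)//.
  apply: sumr_le0 => i _; have [/uJ0->|d'0] := ltP 0 (d' 0 i).
    by rewrite expr0n mulr0.
  by rewrite mulr_le0_ge0 ?sqr_ge0.
have term_ge0 i : 0 <= d 0 i * u 0 i ^+ 2.
  have [/uI0->|d0] := leP (d 0 i) 0; first by rewrite expr0n mulr0.
  by rewrite mulr_ge0 ?sqr_ge0 ?ltW.
rewrite lt0r sumr_ge0 ?andbT => [|i _ //].
apply: contraNneq u0 => /eqP; rewrite psumr_eq0 => [/allP S0|i _ //].
apply/eqP/rowP => i; rewrite mxE; have [/uI0//|d0] := leP (d 0 i) 0.
have := S0 i (mem_index_enum i).
by rewrite mulf_eq0 (gt_eqF d0) sqrf_eq0 => /eqP.
Qed.

(** A congruence may change the eigenvalues, so diagonal forms of both matrices are compared by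
    [inertia_leq], in both directions thanks to the inverse of [P]. *)
Lemma signature_congr (R : rcfType) n (P M : 'M[R]_n) :
  P \in unitmx -> M^T = M -> signature (P *m M *m P^T) = signature M.
Proof.
move=> Pu Msym; set N := P *m M *m P^T.
have Nsym : N^T = N by rewrite !trmx_mul trmxK Msym mulmxA.
suff congr_leq (A B : 'M[R]_n) : A^T = A -> B^T = B ->
    (exists2 Q, Q \in unitmx & A = Q *m B *m Q^T) ->
    ((signature A).1 <= (signature B).1)%N /\ ((signature A).2 <= (signature B).2)%N.
  have [] := congr_leq N M Nsym Msym (ex_intro2 _ _ P Pu erefl).
  have [] := congr_leq M N Msym Nsym.
    exists (invmx P); first by rewrite unitmx_inv.
    by rewrite trmx_inv !mulmxA mulVmx// mul1mx mulmxK// unitmx_tr.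
  case: (signature N) (signature M) => a b [a' b'] /= ? ? ? ?.
  by congr pair; apply/eqP; rewrite eqn_leq; apply/andP.
move=> /symmx_spectral[P1 [d [_ P1A ->]]] /symmx_spectral[P2 [d' [P2u P2B ->]]].
move=> [Q _ AE] /=; pose S := P1 *m Q *m invmx P2.
have SE : S *m diag_mx d' *m S^T = diag_mx d.
  rewrite -P1A -P2B AE /S !trmx_mul trmx_inv !mulmxA mulmxKV//.
  by rewrite -[_ *m P2^T *m _]mulmxA mulmxV ?unitmx_tr// mulmx1.
split; first exact: inertia_leq SE.
(* Negating both diagonals reduces the count of negative entries to that of positive ones. *)
apply: (inertia_leq (Q := S)).
have diagN (e : 'rV[R]_n) : diag_mx (- e) = - diag_mx e by exact: raddfN.
by rewrite !diagN mulmxN mulNmx SE.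
Qed.

(** The sign sequences of [d] and [d'] agree up to a permutation; after permuting, ratios of
    matching nonzero entries are positive and have square roots. *)
Lemma diag_mx_congr (R : rcfType) n (d d' : 'rV[R]_n) :
  pos_index d = pos_index d' -> pos_index (- d) = pos_index (- d') ->
  exists2 P, P \in unitmx & P *m diag_mx d' *m P^T = diag_mx d.
Proof.
move=> dd' Ndd'.
have countE x (e : 'rV[R]_n) :
    count_mem x [tuple Num.sg (e 0 i) | i < n] = #|[pred i | Num.sg (e 0 i) == x]|.
  by rewrite count_map cardE /enum_mem size_filter -enumT.
have count1 (e : 'rV[R]_n) : #|[pred i | Num.sg (e 0 i) == 1]| = pos_index e.
  by apply: eq_card => i; rewrite !inE sgr_cp0.
have countN1 (e : 'rV[R]_n) : #|[pred i | Num.sg (e 0 i) == -1]| = pos_index (- e).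
  by apply: eq_card => i; rewrite !inE sgr_cp0 mxE oppr_gt0.
have count0 (e : 'rV[R]_n) :
    (#|[pred i | (Num.sg (e 0 i) == 0)%R]| + (pos_index e + pos_index (- e)) = n)%N.
  rewrite /pos_index -!sum1_card big_mkcond [X in (_ + (X + _))%N]big_mkcond.
  rewrite [X in (_ + (_ + X))%N]big_mkcond -!big_split/=.
  rewrite -[RHS](card_ord n) -sum1_card; apply: eq_bigr => i _.
  by rewrite !inE sgr_eq0 mxE oppr_gt0; case: ltgtP.
have /tuple_permP[s sE] : perm_eq [tuple Num.sg (d 0 i) | i < n]
                             [tuple Num.sg (d' 0 i) | i < n].
  (* The numbers of zeros agree as well, since the three counts add up to [n]. *)
  have c0 : #|[pred i | Num.sg (d 0 i) == 0]| = #|[pred i | Num.sg (d' 0 i) == 0]|.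
    by apply: (@addIn (pos_index d + pos_index (- d))); rewrite count0 dd' Ndd' count0.
  have cE (x y : R) : x = Num.sg y ->
      #|[pred i | Num.sg (d 0 i) == x]| = #|[pred i | Num.sg (d' 0 i) == x]|.
    by case: sgrP => _ -> //; rewrite ?count1 ?countN1.
  apply/allP => x; rewrite mem_cat /= !countE => /orP[]/mapP[i _ xE];
  by apply/eqP; apply: cE xE.
have {sE}sE i : Num.sg (d 0 i) = Num.sg (d' 0 (s i)).
  by have /val_inj/(congr1 (fun t => tnth t i)) := sE; rewrite !tnth_mktuple.
(* The value 1 at zero entries keeps the scaling invertible. *)
pose c i := if d 0 i == 0 then 1 else Num.sqrt (d 0 i / d' 0 (s i)).
have cP i : c i != 0 /\ c i * d' 0 (s i) * c i = d 0 i.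
  rewrite /c; have [d0|d0] := eqVneq (d 0 i) 0.
    have := sE i; rewrite d0 sgr0 => /esym/eqP; rewrite sgr_eq0 => /eqP->.
    by rewrite mulr0 mul0r oner_eq0.
  have d'0 : d' 0 (s i) != 0 by rewrite -sgr_eq0 -sE sgr_eq0.
  have r0 : 0 < d 0 i / d' 0 (s i).
    by rewrite -sgr_cp0 sgrM sgrV sE -expr2 sqr_sg d'0.
  split; first by rewrite sqrtr_eq0 -ltNge.
  by rewrite mulrAC -expr2 sqr_sqrtr ?ltW// mulfVK.
exists (diag_mx (\row_i c i) *m perm_mx s).
  rewrite unitmx_mul unitmx_perm andbT unitmxE det_diag unitfE.
  by apply/prodf_neq0 => i _; rewrite mxE (cP i).1.
rewrite trmx_mul tr_diag_mx tr_perm_mx mulmxA -[_ *m perm_mx s *m _]mulmxA.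
rewrite -row_permE -[_ *m _ *m perm_mx _]mulmxA -col_permE mul_mx_diag mul_diag_mx.
apply/matrixP => i j; rewrite !mxE (inj_eq perm_inj).
have [->|_] := eqVneq i j; last by rewrite !mulr0n mulr0 mul0r.
by rewrite !mulr1n (cP j).2.
Qed.

Lemma symmx_congr (R : rcfType) n (M N : 'M[R]_n) :
  M^T = M -> N^T = N -> signature M = signature N ->
  exists2 P, P \in unitmx & P *m N *m P^T = M.
Proof.
move=> /symmx_spectral[P [d [Pu PM ->]]] /symmx_spectral[P' [d' [P'u PN ->]]].
move=> [] dd' Ndd'; have [Q Qu QE] := diag_mx_congr dd' Ndd'.
exists (invmx P *m Q *m P'); first by rewrite !unitmx_mul unitmx_inv Pu Qu.
rewrite !trmx_mul trmx_inv; apply: (can_inj (mulKmx Pu)).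
have PTu : P^T \in unitmx by rewrite unitmx_tr.
apply: (can_inj (mulmxK PTu)); rewrite PM -QE -PN !mulmxA mulmxV// mul1mx.
by rewrite mulmxKV.
Qed.

(** * Cohomology classes as matrices *)

Lemma mkedgeC n (i j : 'I_n) : mkedge i j = mkedge j i.
Proof. by apply/val_inj; rewrite /= finset.setUC. Qed.

Section Cochains.
Variables (R : realType) (n : nat).
Implicit Types (G : graph n).

Lemma cochain_mxC G (f : C1 R G) i j : cochain_mx f i j = cochain_mx f j i.
Proof. by rewrite !mxE mkedgeC. Qed.

Lemma cochain_mx_edge G (f : C1 R G) (e : {e : edge n | e \in G}) :
  cochain_mx f (ends (val e)).1 (ends (val e)).2 = - expR (f e).
Proof. by rewrite mxE mkedge_ends valK. Qed.

(** Exponentials never vanish, so the zero pattern of the matrix recovers the graph. *)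
Lemma cochain_mx_eq0 G (f : C1 R G) i j :
  (cochain_mx f i j == 0) = (mkedge i j \notin G).
Proof.
rewrite mxE; case: insubP => [e -> _|->]; last by rewrite eqxx.
by rewrite oppr_eq0 gt_eqF ?expR_gt0.
Qed.

Lemma cochain_mx_le0 G (f : C1 R G) i j : cochain_mx f i j <= 0.
Proof. by rewrite mxE; case: insubP => // e _ _; rewrite oppr_le0 expR_ge0. Qed.

Definition cohomology_class G (f : C1 R G) : H1S n R :=
  Tagged (fun G => H1 R G) (\pi_(H1 R G) f).

Lemma cohomology_class_repr (c : H1S n R) : cohomology_class (repr (tagged c)) = c.
Proof. by case: c => G c; rewrite /cohomology_class reprK. Qed.

(** Allowing two graphs turns equality in the disjoint union into a condition on matrices alone. *)
Lemma cohomology_classP G G' (f : C1 R G) (f' : C1 R G') :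
  cohomology_class f = cohomology_class f' <->
  exists c : 'I_n -> R, (forall i, 0 < c i) /\
    forall i j, cochain_mx f i j = c i * c j * cochain_mx f' i j.
Proof.
split=> [E|[c [c0 E]]].
  have GG' : G = G' := congr1 tag E.
  case: _ / GG' f' E => f' E.
  have {E} /eqP : \pi_(H1 R G) f = \pi_(H1 R G) f'.
    exact: eq_from_Tagged E.
  rewrite -Quotient.idealrBE => /asboolP[g /(canRL (subrK _)) fE].
  exists (fun i => expR (g i)); split=> [i|i j]; first exact: expR_gt0.
  rewrite !mxE; case: insubP => [e _ eE|]; last by rewrite mulr0.
  rewrite fE !ffunE eE edge_funE => [|k l]; last exact: addrC.
  by rewrite !expRD mulrN.
(* Positive factors preserve the zero pattern, hence the graph. *)
have GG' : G = G'.
  apply/setP => e; rewrite -(mkedge_ends e); apply: negb_inj.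
  rewrite -(cochain_mx_eq0 f) -(cochain_mx_eq0 f') E.
  by rewrite !mulf_eq0 !(gt_eqF (c0 _)).
case: _ / GG' f' E => f' E; congr Tagged.
apply/eqP; rewrite -Quotient.idealrBE; apply/asboolP.
exists [ffun i => ln (c i)]; apply/ffunP => e; rewrite !ffunE /edge_fun !ffunE.
have := E (ends (val e)).1 (ends (val e)).2; rewrite !cochain_mx_edge mulrN.
move/oppr_inj/(congr1 (@ln R)); rewrite !lnM ?posrE ?mulr_gt0 ?expR_gt0//.
by rewrite !expRK => ->; rewrite addrK.
Qed.

(** [sgn] is computed on a chosen representative, whose matrix differs from that of [f] by an
    invertible diagonal congruence. *)
Lemma sgn_cohomology_class G (f : C1 R G) :
  sgn (cohomology_class f) = signature (cochain_mx f).
Proof.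
rewrite /sgn; set f' := repr _.
have /cohomology_classP[c [c0 E]] : cohomology_class f' = cohomology_class f.
  by rewrite cohomology_class_repr.
have -> : cochain_mx f' =
    diag_mx (\row_i c i) *m cochain_mx f *m (diag_mx (\row_i c i))^T.
  rewrite tr_diag_mx mul_mx_diag mul_diag_mx; apply/matrixP => i j.
  by rewrite E !mxE mulrAC.
apply: signature_congr; last by apply/matrixP => i j; rewrite [LHS]mxE cochain_mxC.
rewrite unitmxE det_diag unitfE; apply/prodf_neq0 => i _.
by rewrite mxE gt_eqF.
Qed.

End Cochains.

(** * Marked simplices as bases *)

Section Simplices.
Variables (R : realType) (n : nat).
Local Notation V := 'rV[R]_n.
Variable b : {symmetric V}.
Local Notation B := (matrix_of_form b).
Implicit Types (m : marked_simplex b).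

Lemma form_mxE u v : b u v = (u *m B *m v^T) 0 0.
Proof.
by rewrite -[LHS](matrix_of_formK b) /form_of_matrix trace_mx11 map_mx_id.
Qed.

Lemma symm_formC u v : b u v = b v u.
Proof. by rewrite hermC expr0 mul1r. Qed.

Lemma matrix_of_form_sym : B^T = B.
Proof. by apply/matrixP => i j; rewrite !mxE symm_formC. Qed.

Lemma gram_mxE (P : 'M[R]_n) i j : (P *m B *m P^T) i j = b (row i P) (row j P).
Proof.
rewrite form_mxE tr_row -row_mul.
by rewrite [RHS]mxE [LHS]mxE; apply: eq_bigr => k _; rewrite !mxE.
Qed.

Lemma formZ k l u v : b (k *: u) (l *: v) = k * l * b u v.
Proof. by rewrite linearZl_LR linearZr_LR /= mulrA. Qed.

Lemma orthov_vline u v : (<[u]> <= orthov b <[v]>)%VS = (b u v == 0).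
Proof.
rewrite -memvE; apply/mem_orthovP/eqP => [->//|uv0 _ /vlineP[k ->]].
  exact: memv_line.
by rewrite linearZ /= uv0 mulr0.
Qed.

(** * Lifts of a marked simplex as matrices *)

Lemma marked_simplexP m :
  exists2 L, simplex b L & set_bij [set: 'I_n] L (val m).
Proof. exact/asboolP/(valP m). Qed.

Lemma marked_simplex_inj m : injective (val m).
Proof.
have [L _ [_ mI _]] := marked_simplexP m.
by move=> i j; apply: mI; rewrite inE.
Qed.

(** The lifted vertices are stored as rows, so that their Gram matrix is [P *m B *m P^T];
    invertibility of [P] is stated separately. *)
Definition frame m (P : 'M[R]_n) :=
  (forall i, val (val m i) = <[row i P]>%VS) /\ (forall i j, b (row i P) (row j P) <= 0).

Lemma frame_row_neq0 m P i : frame m P -> row i P != 0.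
Proof.
case=> mE _; apply: contraTneq (valP (val m i)) => Pi0.
by rewrite mE Pi0 dim_vline eqxx.
Qed.

(** The sign condition makes [- expR (ln |b|)] equal to [b] on edges, and non-edges are exactly the
    zero entries of the Gram matrix. *)
Lemma cR_frame m P : frame m P ->
  exists G (f : C1 R G), cR m = cohomology_class f /\ cochain_mx f = P *m B *m P^T.
Proof.
move=> mP; have [mE Ple0] := mP.
(* Well defined because the marking is injective; the default 0 is only taken off the vertices. *)
pose s x : V := if [pick i | val m i == x] is Some i then row i P else 0.
have sE i : s (val m i) = row i P.
  rewrite /s; case: pickP => [j /eqP/marked_simplex_inj -> //|/(_ i)].
  by rewrite eqxx.
have sl : is_lift (range (val m)) s.
  move=> _ [i _ <-]; rewrite sE mE memv_line; split=> //.
  exact: frame_row_neq0 mP.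
exists (simplex_graph m), (lift_cochain s m); split; first exact: cRE.
have edgeE i j : (mkedge i j \in simplex_graph m) = (b (row i P) (row j P) != 0).
  by rewrite inE edge_funE => [|k l]; rewrite !mE !orthov_vline // symm_formC.
apply/matrixP => i j; rewrite gram_mxE mxE.
case: insubP => [e _ eE|]; last by rewrite edgeE negbK => /eqP.
have bN0 : b (row i P) (row j P) != 0 by rewrite -edgeE -eE (valP e).
pose h k l := ln `|b (s (val m k)) (s (val m l))|.
have hC k l : h k l = h l k.
  exact: (congr1 (fun t => ln `|t|) (symm_formC (s (val m k)) (s (val m l)))).
rewrite ffunE eE (edge_funE i j hC) /h.
by rewrite !sE lnK ?posrE ?normr_gt0// ler0_norm ?Ple0// opprK.
Qed.

Lemma proj_vline (x : proj R n) v : v \in val x -> v != 0 -> val x = <[v]>%VS.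
Proof.
move=> xv v0; apply/esym/eqP; rewrite eqEdim -memvE xv dim_vline v0.
by rewrite (eqP (valP x)).
Qed.

Lemma frame_exists m : exists2 P, frame m P & P \in unitmx.
Proof.
have [L [_ spL [s [sl _ sle0] _]] [mL _ mLs]] := marked_simplexP m.
have Lm i : L (val m i) by apply: mL.
pose P := \matrix_i s (val m i); exists P.
  split=> [i|i j]; rewrite !rowK; last exact: sle0.
  by have [? ?] := sl _ (Lm i); apply: proj_vline.
rewrite -unitmx_tr -row_free_unit; apply/inj_row_free => y yP.
(* The kernel of the functional given by [y] contains every row of [P], hence every vertex; spanning
   makes it the whole space, so [y = 0]. *)
pose U := lker (linfun (mulmxr y^T : V -> 'M_1)).
have UT : U = fullv.
  apply: spL => x /mLs[i _ <-]; have [? ?] := sl _ (Lm i).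
  rewrite (proj_vline (v := s (val m i)))// -memvE memv_ker lfunE /=.
  have -> : s (val m i) = row i P by rewrite rowK.
  by rewrite -row_mul -(trmxK P) -trmx_mul yP trmx0 row0.
apply/rowP => i; rewrite mxE.
have : delta_mx 0 i \in U by rewrite UT memvf.
rewrite memv_ker lfunE /= -rowE => /eqP/matrixP/(_ 0 0).
by rewrite !mxE.
Qed.

Lemma sgn_cR m : sgn (cR m) = signature B.
Proof.
have [P mP Pu] := frame_exists m; have [G [f [-> fE]]] := cR_frame mP.
by rewrite sgn_cohomology_class fE signature_congr// matrix_of_form_sym.
Qed.

Lemma lfun_mxE (Q : 'M[R]_n) (u : V) : linfun (mulmxr Q : V -> V) u = u *m Q.
Proof. by rewrite lfunE. Qed.

(** * Isometric marked simplices are those with the same class *)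

Lemma cR_isometric m m' : isometric m m' -> cR m = cR m'.
Proof.
move=> /asboolP[phi [g [_ gb] phiE] mm'].
have [P [mE Ple0] _] := frame_exists m.
(* The linear isometry carries a frame of [m] to a frame of [m'] with the same Gram matrix. *)
pose P' := \matrix_i g (row i P).
have Pb i j : b (row i P') (row j P') = b (row i P) (row j P) by rewrite !rowK gb.
have [G [f [-> fE]]] := cR_frame (conj mE Ple0).
have [|G' [f' [-> f'E]]] := @cR_frame m' P'.
  split=> [i|i j]; last by rewrite Pb.
  by rewrite mm' phiE mE limg_line rowK.
apply/cohomology_classP; exists (fun=> 1); split=> [_|i j]; first exact: ltr01.
by rewrite !mul1r fE f'E !gram_mxE Pb.
Qed.

Lemma isometric_cR m m' : cR m = cR m' -> isometric m m'.
Proof.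
have [P mP Pu] := frame_exists m; have [P' mP' P'u] := frame_exists m'.
have [G [f [-> fE]]] := cR_frame mP; have [G' [f' [-> f'E]]] := cR_frame mP'.
move=> /cohomology_classP[c [c0 cE]].
(* Rescaling the frame of [m'] by [c] gives it the Gram matrix of the frame of [m]. *)
pose W := diag_mx (\row_i c i) *m P'.
have rowW i : row i W = c i *: row i P'.
  by apply/rowP => j; rewrite /W mul_diag_mx !mxE.
have WB : W *m B *m W^T = P *m B *m P^T.
  apply/matrixP => i j; rewrite (gram_mxE W) !rowW formZ -gram_mxE -f'E -cE.
  by rewrite fE.
(* The linear map sending the basis [P] to the basis [W]; equal Gram matrices make it preserve
   [b]. *)
pose Q := invmx P *m W; pose g := linfun (mulmxr Q : V -> V).
have gP i : g (row i P) = c i *: row i P'.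
  by rewrite lfun_mxE -row_mul mulKVmx// rowW.
have Wu : W \in unitmx.
  rewrite unitmx_mul P'u andbT unitmxE det_diag unitfE.
  by apply/prodf_neq0 => i _; rewrite mxE gt_eqF.
have g0 : lker g = 0%VS.
  apply/eqP/lker0P => u v; rewrite !lfun_mxE; apply: (can_inj (mulmxK _)).
  by rewrite unitmx_mul unitmx_inv Pu.
apply/asboolP.
exists (fun x => exist (fun l => is_true (\dim l == 1%N)) _ (proj_map_proof x g0)).
  exists g => //; split=> // u v; rewrite !form_mxE !lfun_mxE trmx_mul.
  have QB : Q *m B *m Q^T = B.
    have -> : Q *m B *m Q^T = invmx P *m (W *m B *m W^T) *m (invmx P)^T.
      by rewrite /Q trmx_mul !mulmxA.
    by rewrite WB !mulmxA mulVmx// mul1mx trmx_inv mulmxK ?unitmx_tr.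
  by rewrite -[in RHS]QB !mulmxA.
move=> i; apply/val_inj; rewrite /= mP.1 mP'.1 limg_line gP.
apply/esym/eqP; rewrite eqEdim !dim_vline (frame_row_neq0 i mP') scaler_eq0 negb_or.
by rewrite (gt_eqF (c0 i)) (frame_row_neq0 i mP') andbT -memvE memvZ ?memv_line.
Qed.

(** * The simplex carried by a basis *)

Section FrameSimplex.
Variable P : 'M[R]_n.
Hypotheses (Pu : P \in unitmx) (Ple0 : forall i j, b (row i P) (row j P) <= 0).

Lemma row_unitmx_neq0 i : row i P != 0.
Proof.
rewrite rowE mulmx_free_eq0 ?row_free_unit//; apply/eqP => /matrixP/(_ 0 i)/eqP.
by rewrite !mxE !eqxx oner_eq0.
Qed.

Fact frame_line_proof i : \dim <[row i P]>%VS == 1%N.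
Proof. by rewrite dim_vline row_unitmx_neq0. Qed.

Definition frame_line i : proj R n :=
  exist (fun l => is_true (\dim l == 1%N)) _ (frame_line_proof i).

(** Here [a] holds the coordinates in the basis of rows of [P], where line [i] is the [i]-th
    coordinate axis. *)
Lemma row_mem_frame_line i j a : a *m P \in val (frame_line i) ->
  j != i -> a 0 j = 0.
Proof.
move=> /vlineP[k]; rewrite rowE scalemxAl => /(can_inj (mulmxK Pu)) -> ji.
by rewrite !mxE eqxx (negPf ji) mulr0.
Qed.

Lemma frame_line_inj : injective frame_line.
Proof.
move=> i j /(congr1 val)/= E; apply/eqP; apply: contraTT isT => ij.
have : (delta_mx 0 i : 'rV_n) *m P \in val (frame_line j) by rewrite -rowE /= -E memv_line.
move/row_mem_frame_line/(_ ij)/eqP.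
by rewrite !mxE !eqxx oner_eq0.
Qed.

Definition frame_lift (x : proj R n) : V :=
  if [pick i | frame_line i == x] is Some i then row i P else 0.

Lemma frame_liftE i : frame_lift (frame_line i) = row i P.
Proof.
rewrite /frame_lift; case: pickP => [j /eqP/frame_line_inj -> //|/(_ i)].
by rewrite eqxx.
Qed.

Lemma frame_simplex : simplex b (range frame_line).
Proof.
split.
- rewrite (card_eql (inj_card_eq _)) => [|? ? _ _ /frame_line_inj//].
  by rewrite card_eq_sym card_II.
- move=> U UL; apply/vspaceP => u; rewrite memvf -(mulmxKV Pu u) mulmx_sum_row.
  rewrite rpred_sum// => i _; rewrite memvZ// memvE.
  by apply: (UL (frame_line i)); exists i.
- exists frame_lift.
    split=> [_ [i _ <-]|C0|_ _ [i _ <-] [j _ <-]]; last by rewrite !frame_liftE.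
      rewrite frame_liftE memv_line; split=> //.
      exact: row_unitmx_neq0.
    (* The rows of P lie on the affine hyperplane h = 1. *)
    pose h (u : V) := (u *m invmx P *m (const_mx 1 : 'cV_n)) 0 0 : R.
    (* This hyperplane is convex, so it contains the whole hull, whereas [h 0 = 0]. *)
    suff : [set u : V | h u = 1] 0.
      by rewrite /= /h !mul0mx mxE => /esym/eqP; rewrite oner_eq0.
    apply: C0; split.
      move=> u v l /set_mem/= hu /set_mem/= hv; apply/mem_set => /=.
      have hD a c : h (a *: u + c *: v) = a * h u + c * h v.
        by rewrite /h !mulmxDl -!scalemxAl !mxE.
      by rewrite [LHS]hD hu hv !mulr1 add_onemK.
    move=> _ [_ [i _ <-] <-]; rewrite /= frame_liftE /h rowE mulmxK// -rowE.
    by rewrite !mxE.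
  move=> _ [j _ <-] k y t yL t0 _ yt i.
  have {}yL i' : exists z, frame_line z = y i' by have [z _ zE] := yL i'; exists z.
  have [z zE] := choice yL.
  rewrite -zE; congr frame_line; apply/eqP; apply: contraTT isT => zj.
  (* Coordinates of the convex combination: coordinate [z i] must vanish, yet it is a sum of
     nonnegative terms one of which is [t i > 0]. *)
  pose a : 'rV[R]_n := \sum_i t i *: delta_mx 0 (z i).
  have aP : a *m P \in val (frame_line j).
    rewrite (_ : a *m P = \sum_i t i *: frame_lift (y i))// mulmx_suml.
    by apply: eq_bigr => i' _; rewrite -zE frame_liftE rowE scalemxAl.
  have := row_mem_frame_line aP zj; rewrite summxE => /eqP.
  rewrite psumr_eq0 => [/allP/(_ i (mem_index_enum i))|i' _].
    by rewrite !mxE !eqxx mulr1 gt_eqF.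
  by rewrite !mxE eqxx mulr_ge0 ?ler0n ?ltW.
Qed.

Fact frame_marked_simplex_proof :
  `[< exists2 L, simplex b L &
      set_bij [set: 'I_n] L [ffun i => frame_line i] >].
Proof.
apply/asboolP; exists (range frame_line); first exact: frame_simplex.
split=> [i _|i j _ _|_ [i _ <-]].
- by rewrite ffunE; exists i.
- by rewrite !ffunE => /frame_line_inj.
- by exists i; rewrite ?ffunE.
Qed.

Definition frame_marked_simplex : marked_simplex b :=
  exist _ [ffun i => frame_line i] frame_marked_simplex_proof.

Lemma frame_marked_simplexP : frame frame_marked_simplex P.
Proof. by split=> // i; rewrite /= ffunE. Qed.

End FrameSimplex.

Lemma cR_surj (c : H1S n R) : sgn c = signature B -> exists m, cR m = c.
Proof.
rewrite -(cohomology_class_repr c) sgn_cohomology_class; set M := cochain_mx _ => cB.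
have [|P Pu PM] := symmx_congr _ matrix_of_form_sym cB.
  by apply/matrixP => i j; rewrite [LHS]mxE cochain_mxC.
(* Nonpositivity of cochain matrices is exactly the sign condition of a positive lift. *)
have Ple0 i j : b (row i P) (row j P) <= 0.
  by rewrite -gram_mxE PM cochain_mx_le0.
exists (frame_marked_simplex Pu Ple0).
have [G [f [-> fE]]] := cR_frame (frame_marked_simplexP Pu Ple0).
apply/cohomology_classP; exists (fun=> 1); split=> [_|i j]; first exact: ltr01.
by rewrite !mul1r fE PM.
Qed.

End Simplices.

(** * Descent of [cR] to isometry classes *)

Theorem mainTheorem4 (R : realType) (p q : nat)
    (b : {symmetric 'rV[R]_(p + q).+1})
    (hp : (0 < p)%N)
    (hb : nondegenerate b)
    (hsgn : signature (matrix_of_form b) = (p, q.+1)) :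
  exists F : isometry_class b -> H1S (p + q).+1 R,
    (forall m : marked_simplex b, F (\pi_(isometry_class b) m) = cR m) /\
    set_bij [set: isometry_class b]
            [set c : H1S (p + q).+1 R | sgn c = (p, q.+1)] F.
Proof.
(* The map is defined on chosen representatives; isometry invariance makes it agree with [cR]
   everywhere. *)
have cR_repr m : cR (repr (\pi_(isometry_class b) m)) = cR m.
  by apply: cR_isometric; apply/eqmodP; rewrite reprK.
exists (fun x => cR (repr x)); split=> //; split=> [x _|x y _ _ E|c /= cE].
- by rewrite /= sgn_cR.
- by rewrite -[x]reprK -[y]reprK; apply/eqmodP/isometric_cR.
- rewrite -hsgn in cE; have [m <-] := cR_surj cE.
  by exists (\pi_(isometry_class b) m).
Qed.
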